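(* Let $S \subset \mathbb{R}^D$ be compact, let $\mathcal{X} = \{x_1,\dots,x_N\} \subset S$ be a finite sample, and let $\varepsilon = \sup_{x \in S} \min_i \|x - x_i\|$. For $r > 0$, form the corresponding $r$-ball graph. When $\varepsilon \le r/4$, we have $$\Delta_r(x,x') \le (1 + 4\varepsilon/r)\, \delta_S(x,x'), \qquad \forall x,x' \in \mathcal{X}.$$
   Context: Intrinsic metric: for $x,x' \in S$, $\delta_S(x,x') = \inf\{a : \exists\, \gamma : [0,a] \to S \text{ 1-Lipschitz with } \gamma(0) = x,\ \gamma(a) = x'\}$ (equal to $\infty$ if there is no such $\gamma$). $r$-ball graph: the weighted graph on $\{1,\dots,N\}$ with $i \sim j$ if and only if $\|x_i - x_j\| \le r$, and edge weight $w_r(i,j) = \|x_i - x_j\|$ if $i \sim j$, $w_r(i,j) = \infty$ otherwise. For sample points, $\Delta_r(x_i,x_j) = \min\{\sum_{l=1}^{m-1} w_r(k_l,k_{l+1}) : m \ge 1, k_1 = i, k_m = j\}$ is the shortest-path distance between $i$ and $j$ in this graph. *)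

(* Defs.v *)
From mathcomp Require Import all_boot all_order all_algebra.
From mathcomp Require Import all_classical all_reals all_analysis.

Set Implicit Arguments.
Unset Strict Implicit.
Unset Printing Implicit Defensive.

Import Order.TTheory GRing.Theory Num.Theory.

Import numFieldNormedType.Exports.

Local Open Scope classical_set_scope.
Local Open Scope ring_scope.

(* The library norm `|v| on 'rV[R]_D is the sup norm; the distances below are
   Euclidean.  The two norms induce the same topology, so that [compact] on
   sets of row vectors has its usual meaning. *)
Definition enorm (R : realType) (D : nat) (v : 'rV[R]_D) : R :=
  Num.sqrt (\sum_(l < D) v ord0 l ^+ 2).

(* Only the values of gamma on [0, a] matter. *)
Definition lip1_path (R : realType) (D : nat) (S : set 'rV[R]_D)
    (x x' : 'rV[R]_D) (a : R) (gamma : R -> 'rV[R]_D) : Prop :=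
  [/\ forall t, t \in `[0, a] -> S (gamma t),
      forall s t, s \in `[0, a] -> t \in `[0, a] ->
        enorm (gamma s - gamma t) <= `|s - t|,
      gamma 0 = x & gamma a = x'].

Definition intrinsic_dist (R : realType) (D : nat) (S : set 'rV[R]_D)
    (x x' : 'rV[R]_D) : \bar R :=
  ereal_inf [set a%:E | a in
    [set a : R | 0 <= a /\ exists gamma, lip1_path S x x' a gamma]].

Definition covering_radius (R : realType) (D N : nat) (S : set 'rV[R]_D)
    (x : 'I_N -> 'rV[R]_D) : \bar R :=
  ereal_sup [set \big[mine/+oo%E]_(i < N) (enorm (y - x i))%:E | y in S].

Definition ball_adj (R : realType) (D N : nat) (x : 'I_N -> 'rV[R]_D) (r : R) :
    rel 'I_N :=
  fun i j => enorm (x i - x j) <= r.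

Definition ball_weight (R : realType) (D N : nat) (x : 'I_N -> 'rV[R]_D)
    (r : R) (i j : 'I_N) : \bar R :=
  if ball_adj x r i j then (enorm (x i - x j))%:E else +oo%E.

(* The vertices of the walk are k 1, ..., k m.  The infimum is a minimum: the
   weights are nonnegative and removing loops never increases the length, so
   only the finitely many walks with m <= N matter. *)
Definition graph_dist (R : realType) (D N : nat) (x : 'I_N -> 'rV[R]_D)
    (r : R) (i j : 'I_N) : \bar R :=
  ereal_inf [set d | exists (m : nat) (k : nat -> 'I_N),
    [/\ (1 <= m)%N, k 1%N = i, k m = j &
        d = (\sum_(1 <= l < m) ball_weight x r (k l) (k l.+1))%E]].

(* Main.v *)
(* Cut a curve of length [a] into [n] equal pieces with [n - 1 <= 2 a / r < n],
   and replace each interior division point by a sample point within [eps].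
   Consecutive sample points are at distance at most
   [a / n + 2 eps <= r / 2 + r / 2], so they form a walk in the [r]-ball graph;
   since the two ends need no replacement, its length is at most
   [a + 2 (n - 1) eps <= (1 + 4 eps / r) a]. *)
Require Import Defs.
From mathcomp Require Import all_boot all_order all_algebra.
From mathcomp Require Import all_classical all_reals all_analysis.
From mathcomp Require Import ring lra.

Import Order.TTheory GRing.Theory Num.Theory.
Import numFieldNormedType.Exports.

Local Open Scope classical_set_scope.
Local Open Scope ring_scope.

(** Lagrange's identity: twice the difference of the two sides is the sum over all pairs of
    [(a i * b j - a j * b i) ^+ 2]. *)
Lemma cauchy_schwarz_sum {R : realFieldType} {I : finType} (a b : I -> R) :
  (\sum_i a i * b i) ^+ 2 <= (\sum_i a i ^+ 2) * (\sum_i b i ^+ 2).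
Proof.
pose P := \sum_i \sum_j a i ^+ 2 * b j ^+ 2.
have EP : (\sum_i a i ^+ 2) * (\sum_i b i ^+ 2) = P.
  by rewrite mulr_suml; apply: eq_bigr => i _; rewrite mulr_sumr.
have EP' : P = \sum_i \sum_j a j ^+ 2 * b i ^+ 2 by rewrite /P exchange_big.
suff : (\sum_i a i * b i) ^+ 2 *+ 2 <= P + P by rewrite EP -mulr2n lerMn2r.
rewrite {2}EP' -big_split /= expr2 mulr_suml -sumrMnl; apply: ler_sum => i _.
rewrite -big_split mulr_sumr -sumrMnl; apply: ler_sum => j _ /=.
by have := sqr_ge0 (a i * b j - a j * b i); nra.
Qed.

Section EuclideanNorm.
Context {R : realType} {D : nat}.
Implicit Types u v w : 'rV[R]_D.

Lemma enorm_ge0 v : 0 <= enorm v.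
Proof. exact: sqrtr_ge0. Qed.

Lemma enorm0 : enorm (0 : 'rV[R]_D) = 0.
Proof.
by rewrite /enorm big1 ?sqrtr0// => l _; rewrite mxE expr0n.
Qed.

Lemma sqr_enorm v : enorm v ^+ 2 = \sum_(l < D) v ord0 l ^+ 2.
Proof. by rewrite sqr_sqrtr// sumr_ge0// => l _; exact: sqr_ge0. Qed.

Lemma enormN v : enorm (- v) = enorm v.
Proof. by congr Num.sqrt; apply: eq_bigr => l _; rewrite mxE sqrrN. Qed.

Lemma enormB u v : enorm (u - v) = enorm (v - u).
Proof. by rewrite -enormN opprB. Qed.

Lemma enormD u v : enorm (u + v) <= enorm u + enorm v.
Proof.
have uv0 := mulr_ge0 (enorm_ge0 u) (enorm_ge0 v).
have dot_le : \sum_(l < D) u ord0 l * v ord0 l <= enorm u * enorm v.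
  have := cauchy_schwarz_sum (fun l => u ord0 l) (fun l => v ord0 l).
  rewrite -!sqr_enorm -exprMn => h.
  apply: (le_trans (ler_norm _)).
  by rewrite -(ler_pXn2r (n := 2)) ?nnegrE// real_normK ?num_real.
rewrite -(ler_pXn2r (n := 2)) ?nnegrE ?addr_ge0 ?enorm_ge0//.
have -> : enorm (u + v) ^+ 2 =
    enorm u ^+ 2 + enorm v ^+ 2 + (\sum_(l < D) u ord0 l * v ord0 l) *+ 2.
  rewrite !sqr_enorm -sumrMnl -!big_split; apply: eq_bigr => l _ /=.
  by rewrite mxE sqrrD; ring.
by rewrite sqrrD; nra.
Qed.

Lemma ler_enormB w u v : enorm (u - v) <= enorm (u - w) + enorm (w - v).
Proof. by rewrite -[u - v](subrKA w) enormD. Qed.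

End EuclideanNorm.

Lemma covering_radius_nearest {R : realType} {D N : nat} (S : set 'rV[R]_D)
    (x : 'I_N -> 'rV[R]_D) (eps : R) y :
  S y -> (covering_radius S x <= eps%:E)%E ->
  exists i, enorm (y - x i) <= eps.
Proof.
move=> Sy le_eps.
have : (\big[mine/+oo]_(i < N) (enorm (y - x i))%:E <= eps%:E)%E.
  by apply: le_trans le_eps; apply: ereal_sup_ubound; exists y.
(* Either the default [+oo] of the minimum is at most [eps], which is absurd, or some sample point
   attains the bound; this also rules out [N = 0]. *)
by case/bigmin_leP => [|[i _]]; rewrite ?leye_eq// lee_fin => ?; exists i.
Qed.

(** A point of [S] is required because the supremum over an empty set is [-oo]. *)
Lemma covering_radius_ge0 {R : realType} {D N : nat} (S : set 'rV[R]_D)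
    (x : 'I_N -> 'rV[R]_D) y :
  S y -> (0 <= covering_radius S x)%E.
Proof.
move=> Sy; apply: (@le_trans _ _ (\big[mine/+oo]_(i < N) (enorm (y - x i))%:E)%E).
  by apply: le_bigmin => [|i _]; rewrite ?leey// lee_fin enorm_ge0.
by apply: ereal_sup_ubound; exists y.
Qed.

(** The bounds [c l] do double duty: being at most [r] they make each step an edge, hence of finite
    weight, and their sum bounds the length of the walk. *)
Lemma graph_dist_walk {R : realType} {D N : nat} (x : 'I_N -> 'rV[R]_D) (r : R)
    (n : nat) (p : nat -> 'I_N) (c : nat -> R) :
  (forall l, (l < n)%N -> enorm (x (p l) - x (p l.+1)) <= c l) ->
  (forall l, (l < n)%N -> c l <= r) ->
  (graph_dist x r (p 0%N) (p n) <= (\sum_(l < n) c l)%:E)%E.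
Proof.
move=> le_c c_le_r.
apply: (@le_trans _ _ (\sum_(1 <= l < n.+1)
    ball_weight x r (p l.-1) (p l.+1.-1))%E).
  (* Walks in [graph_dist] are numbered from 1, whence the shift by [predn]; [n] edges need [n.+1]
     vertices. *)
  by apply: ereal_inf_lbound; exists n.+1, (p \o predn); split.
rewrite big_add1 big_mkord /= -sumEFin; apply: lee_sum => l _.
have le_cl := le_c _ (ltn_ord l).
by rewrite /ball_weight /ball_adj (le_trans le_cl (c_le_r _ (ltn_ord l))) lee_fin.
Qed.

Lemma graph_dist_lip1_path {R : realType} {D N : nat} (S : set 'rV[R]_D)
    (x : 'I_N -> 'rV[R]_D) (r eps a : R) (gamma : R -> 'rV[R]_D) i j :
  0 < r -> 0 <= eps -> eps <= r / 4 ->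
  (forall y, S y -> exists k, enorm (y - x k) <= eps) ->
  0 <= a -> lip1_path S (x i) (x j) a gamma ->
  (graph_dist x r i j <= ((1 + 4 * eps / r) * a)%:E)%E.
Proof.
move=> r0 eps0 eps_r near_sample a0 [gammaS gamma_lip gamma0 gammaa].
have /choice[near nearP] : forall y, exists k, S y -> enorm (y - x k) <= eps.
  move=> y; have [Sy|nSy] := pselect (S y); last by exists i.
  by have [k yk] := near_sample _ Sy; exists k.
have q0 : 0 <= 2 * a / r by rewrite divr_ge0 ?mulr_ge0 ?(ltW r0).
(* There are [m.+1] pieces and [m] interior division points. The strict upper bound on [2 * a / r]
   makes a piece at most [r / 2] long; the lower one limits the number of replacements. One piece
   remains when [a = 0]. *)
set m := Num.truncn (2 * a / r).
have /andP[m_le m_gt] : m%:R <= 2 * a / r < m.+1%:R by exact: truncn_itv.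
pose t (l : nat) : R := l%:R * (a / m.+1%:R).
have step0 : 0 <= a / m.+1%:R by rewrite divr_ge0.
have step_le : a / m.+1%:R <= r / 2.
  by rewrite ler_pdivrMr//; move: m_gt; rewrite ltr_pdivrMr//; lra.
have t0 : t 0%N = 0 by rewrite /t mul0r.
have ta : t m.+1 = a by rewrite /t mulrC divfK// pnatr_eq0.
have t_itv l : (l <= m.+1)%N -> t l \in `[0, a].
  move=> lm; rewrite in_itv /= mulr_ge0//=.
  by rewrite -[leRHS]ta ler_wpM2r// ler_nat.
pose p l := if l == 0%N then i else if l == m.+1 then j else near (gamma (t l)).
(* [e l] bounds the displacement at division point [l]; it vanishes at both ends, which are already
   sample points. *)
pose e l := if l == 0%N then 0 else if l == m.+1 then 0 else eps.
have e_le l : e l <= eps by rewrite /e; do 2 case: ifP => // _.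
have pe l : (l <= m.+1)%N -> enorm (gamma (t l) - x (p l)) <= e l.
  move=> lm; rewrite /p /e; case: eqP => [->|_].
    by rewrite t0 gamma0 subrr enorm0.
  case: eqP => [->|_]; first by rewrite ta gammaa subrr enorm0.
  by apply/nearP/gammaS/t_itv.
pose c l := e l + a / m.+1%:R + e l.+1.
have le_c l : (l < m.+1)%N -> enorm (x (p l) - x (p l.+1)) <= c l.
  move=> lm; apply: (le_trans (ler_enormB (gamma (t l.+1)) _ _)).
  rewrite lerD ?pe//; apply: (le_trans (ler_enormB (gamma (t l)) _ _)).
  rewrite lerD//; first by rewrite enormB pe// ltnW.
  apply: le_trans (gamma_lip _ _ (t_itv _ (ltnW lm)) (t_itv _ lm)) _.
  by rewrite distrC /t -mulrBl -natrB// subSnn mul1r ger0_norm.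
have c_le_r l : (l < m.+1)%N -> c l <= r.
  move=> _; rewrite /c; have := e_le l; have := e_le l.+1.
  by move: (e l) (e l.+1) (a / _) step_le => u v w; lra.
have sum_const : \sum_(l < m) eps = m%:R * eps.
  by rewrite sumr_const card_ord mulr_natl.
(* Each of the two displacement sums loses one end term, leaving [m] terms rather than [m.+1]. With
   [m <= 2 * a / r], their total is at most [4 * eps / r * a]. *)
have sum_e : \sum_(l < m.+1) e l <= m%:R * eps.
  by rewrite big_ord_recl add0r -sum_const; apply: ler_sum => l _; exact: e_le.
have sum_e' : \sum_(l < m.+1) e l.+1 <= m%:R * eps.
  rewrite big_ord_recr /= {2}/e eqxx /= addr0 -sum_const.
  by apply: ler_sum => l _; exact: e_le.
have := graph_dist_walk x r m.+1 p c le_c c_le_r.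
rewrite {1 2}/p !eqxx /= => /le_trans; apply; rewrite lee_fin.
have sum_step : \sum_(l < m.+1) a / m.+1%:R = a.
  by rewrite sumr_const card_ord -[LHS]mulr_natl.
rewrite 2!big_split /= sum_step.
have : m%:R * eps <= 2 * a / r * eps by rewrite ler_wpM2r.
have -> : (1 + 4 * eps / r) * a = a + 2 * (2 * a / r * eps) by ring.
lra.
Qed.

Local Open Scope ereal_scope.

Theorem proposition1 (R : realType) (D N : nat) (S : set 'rV[R]_D)
  (x : 'I_N -> 'rV[R]_D) (r : R) :
  compact S ->
  (forall i, S (x i)) ->
  (0 < r)%R ->
  covering_radius S x <= (r / 4)%:E ->
  forall i j : 'I_N,
    graph_dist x r i j <=
      (1 + 4%:E * covering_radius S x / r%:E) * intrinsic_dist S (x i) (x j).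
Proof.
move=> _ Sx r0 cov_le i j.
have cov0 := covering_radius_ge0 S x (x i) (Sx i).
have [eps cov_eps] : exists eps, covering_radius S x = eps%:E.
  exists (fine (covering_radius S x)); rewrite fineK//.
  by rewrite ge0_fin_numE// (le_lt_trans cov_le) ?ltey.
have nearest y (Sy : S y) := covering_radius_nearest S x eps y Sy.
rewrite cov_eps lexx in nearest; rewrite cov_eps !lee_fin in cov0 cov_le *.
have factor_gt0 : (0 < 1 + 4 * eps / r)%R.
  by rewrite ltr_wpDr// divr_ge0 ?mulr_ge0 ?(ltW r0).
(* A positive real factor passes inside the infimum, so each admissible curve can be treated
   separately; if there is none, the infimum is [+oo]. *)
rewrite inver gt_eqF// -!EFinM -EFinD /intrinsic_dist -ereal_inf_pZl//.
apply: le_ereal_inf_tmp => _ [_ [a [a0 [gamma path_gamma]] <-] <-].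
rewrite -EFinM; apply: graph_dist_lip1_path path_gamma => //.
by move=> y Sy; exact: nearest.
Qed.
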